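(* Let $(\mathcal{A},\mathcal{B},\mathcal{C})$ be a recollement of extriangulated categories with functors $i_*:\mathcal A\to\mathcal B$, $i^*,i^!:\mathcal B\to\mathcal A$, $j^*:\mathcal B\to\mathcal C$, $j_!,j_*:\mathcal C\to\mathcal B$, and let $\mathcal X'$, $\mathcal X$ and $\mathcal X''$ be subcategories of $\mathcal A$, $\mathcal B$ and $\mathcal C$, respectively. Then the following statements hold. (1) $\mathcal X^\perp\text{-}\operatorname{cores.dim}\mathcal B\le \mathcal X''^\perp\text{-}\operatorname{cores.dim}\mathcal C+\max\{\mathcal X^\perp\text{-}\operatorname{cores.dim} i_*(\mathcal A),\ \mathcal X^\perp\text{-}\operatorname{cores.dim} j_*(\mathcal X''^\perp)\}+1$. (2) $\mathcal X^\perp\text{-}\operatorname{cores.dim} i_*(\mathcal A)\le \mathcal X'^\perp\text{-}\operatorname{cores.dim}\mathcal A+\mathcal X^\perp\text{-}\operatorname{cores.dim} i_*(\mathcal X'^\perp)$. (3) $\mathcal X^\perp\text{-}\operatorname{cores.dim}\mathcal B\le \mathcal X'^\perp\text{-}\operatorname{cores.dim}\mathcal A+\mathcal X''^\perp\text{-}\operatorname{cores.dim}\mathcal C+\max\{\mathcal X^\perp\text{-}\operatorname{cores.dim} i_*(\mathcal X'^\perp),\ \mathcal X^\perp\text{-}\operatorname{cores.dim} j_*(\mathcal X''^\perp)\}+1$. (4) $\mathcal X''^\perp\text{-}\operatorname{cores.dim}\mathcal C\le \mathcal X^\perp\text{-}\operatorname{cores.dim}\mathcal B+\mathcal X''^\perp\text{-}\operatorname{cores.dim}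 j^*(\mathcal X^\perp)$. (5) If $j_*(\mathcal X''^\perp)\subseteq\mathcal X^\perp$ and $i_*(\mathcal X'^\perp)\subseteq\mathcal X^\perp$, then $\mathcal X^\perp\text{-}\operatorname{cores.dim}\mathcal B\le \mathcal X'^\perp\text{-}\operatorname{cores.dim}\mathcal A+\mathcal X''^\perp\text{-}\operatorname{cores.dim}\mathcal C+1$. (6) If $j^*(\mathcal X^\perp)\subseteq\mathcal X''^\perp$, then $\mathcal X''^\perp\text{-}\operatorname{cores.dim}\mathcal C\le\mathcal X^\perp\text{-}\operatorname{cores.dim}\mathcal B$. (7) If $i^!$ is exact and $i^!(\mathcal X^\perp)\subseteq\mathcal X'^\perp$, then $\mathcal X'^\perp\text{-}\operatorname{cores.dim}\mathcal A\le\mathcal X^\perp\text{-}\operatorname{cores.dim}\mathcal B$. (8) If $i^!$ is exact, and if $j_*(\mathcal X''^\perp)\subseteq\mathcal X^\perp$, $j^*(\mathcal X^\perp)\subseteq\mathcal X''^\perp$, $i_*(\mathcal X'^\perp)\subseteq\mathcal X^\perp$ and $i^!(\mathcal X^\perp)\subseteq\mathcal X'^\perp$, then $$\max\{\mathcal X'^\perp\text{-}\operatorname{cores.dim}\mathcal A,\ \mathcal X''^\perp\text{-}\operatorname{cores.dim}\mathcal C\}\le \mathcal X^\perp\text{-}\operatorname{cores.dim}\mathcal B\le \mathcal X'^\perp\text{-}\operatorname{cores.dim}\mathcal A+\mathcal X''^\perp\text{-}\operatorname{cores.dim}\mathcal C+1.$$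
   Context: Extriangulated categories (Nakaoka–Palu). An extriangulated category is a triple $(\mathcal C,\mathbb E,\mathfrak s)$ with $\mathcal C$ additive and $\mathbb E:\mathcal C^{op}\times\mathcal C\to\mathrm{Ab}$ an additive bifunctor. For $\delta\in\mathbb E(C,A)$, $a:A\to A'$, $c:C'\to C$ write $a_*\delta=\mathbb E(C,a)(\delta)$, $c^*\delta=\mathbb E(c,A)(\delta)$; a morphism from $\delta\in\mathbb E(C,A)$ to $\delta'\in\mathbb E(C',A')$ is a pair $(a:A\to A',c:C\to C')$ with $a_*\delta=c^*\delta'$. Sequences $A\to B\to C$ and $A\to B'\to C$ are equivalent if there is an isomorphism $B\to B'$ compatible with the identities of $A$ and $C$. $\mathfrak s$ assigns to each $\delta\in\mathbb E(C,A)$ an equivalence class $\mathfrak s(\delta)=[A\to B\to C]$ so that every morphism $(a,c)$ of extensions lifts to a morphism $(a,b,c)$ of realizing sequences, $\mathfrak s(0)=[A\to A\oplus C\to C]$ and $\mathfrak s(\delta\oplus\delta')=\mathfrak s(\delta)\oplus\mathfrak s(\delta')$. Axioms: (ET3) if $A\xrightarrow{x}B\xrightarrow{y}C$, $A'\xrightarrow{x'}B'\xrightarrow{y'}C'$ realize $\delta,\delta'$ and $bx=x'a$, there is $c$ with $cy=y'b$ and $(a,c):\delta\to\delta'$ a morphism; (ET4) if $A\xrightarrow{f}B\xrightarrow{f'}D$ realizes $\delta$ and $B\xrightarrow{g}C\xrightarrow{g'}F$ realizes $\delta'$, there are an object $E$, $\delta''\in\mathbb E(E,A)$ realized by $A\xrightarrow{gf}C\xrightarrow{h'}E$,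 and $d:D\to E$, $e:E\to F$ with $df'=h'g$, $eh'=g'$, such that $D\xrightarrow{d}E\xrightarrow{e}F$ realizes $f'_*\delta'$, $d^*\delta''=\delta$, $f_*\delta''=e^*\delta'$; and the duals (ET3)$^{op}$, (ET4)$^{op}$. If $A\xrightarrow{x}B\xrightarrow{y}C$ realizes some $\delta$, it is an $\mathbb E$-triangle ($A\to B\to C\dashrightarrow$), $x$ is an inflation and $y$ a deflation. Standing assumptions. Every extriangulated category satisfies (WIC): for composable $f,g$, if $gf$ is an inflation then $f$ is an inflation, and if $gf$ is a deflation then $g$ is a deflation. Every extriangulated category has enough projectives and enough injectives: $P$ is projective if every morphism $P\to C$ lifts through every deflation $B\to C$; enough projectives means every $M$ is in an $\mathbb E$-triangle $A\to P\to M\dashrightarrow$ with $P$ projective; injectives dually. $\mathcal P(\mathcal C)$, $\mathcal I(\mathcal C)$ are the subcategories of projectives, injectives. All subcategories are full, additive and closed under isomorphisms; for a functor $F$, $F(\mathcal X)$ denotes the class of objects isomorphic to some $F(X)$, $X\in\mathcal X$. Higher extensions. $\mathbb E^1=\mathbb E$ and $\mathbb E^{k+1}(A,B)=\mathbb E(\Omega^kA,B)\cong\mathbb E(A,\Sigma^kB)$ for $k\ge0$, where $\Omega A$ is given by an $\mathbb E$-triangle $\Omega A\to P\to A\dashrightarrow$ with $P$ projective and $\Sigma B$ by $B\to I\to\Sigma B\dashrightarrow$ with $I$ injective. For a subcategory $\mathcal X$ of $\mathcal C$, $\mathcal X^\perp=\{C\in\mathcal C\mid\mathbb E^i(X,C)=0\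 \forall i\ge1,\ X\in\mathcal X\}$. Coresolution dimension. An $\mathbb E$-triangle sequence is a sequence $\cdots\to X_{n+1}\xrightarrow{d_{n+1}}X_n\xrightarrow{d_n}X_{n-1}\to\cdots$ such that there are $\mathbb E$-triangles $K_{n+1}\xrightarrow{g_n}X_n\xrightarrow{f_n}K_n\dashrightarrow$ with $d_n=g_{n-1}f_n$ for all $n$. For a subcategory $\mathcal X$ and object $C$ of $\mathcal C$, $\mathcal X\text{-}\operatorname{cores.dim}C$ is the infimum of the $n\ge0$ for which there is an $\mathbb E$-triangle sequence $0\to C\to X_0\to\cdots\to X_n\to0$ with all $X_i\in\mathcal X$ ($\infty$ if none). For a class $\mathcal C'$ of objects, $\mathcal X\text{-}\operatorname{cores.dim}\mathcal C'=\sup\{\mathcal X\text{-}\operatorname{cores.dim}C\mid C\in\mathcal C'\}$. Exactness (Wang–Wei–Zhang). A morphism is compatible if, whenever it is both an inflation and a deflation, it is an isomorphism. A sequence $A\xrightarrow{f}B\xrightarrow{g}C$ is right exact if there are an $\mathbb E$-triangle $K\xrightarrow{h_2}B\xrightarrow{g}C\dashrightarrow$ and a compatible deflation $h_1:A\to K$ with $f=h_2h_1$; it is left exact if there are an $\mathbb E$-triangle $A\xrightarrow{f}B\xrightarrow{h_2}K\dashrightarrow$ and a compatible inflation $h_1:K\to C$ with $g=h_1h_2$. A four-term $\mathbb E$-triangle sequence $A\xrightarrow{f}B\xrightarrow{g}C\xrightarrow{h}D$ is right exact (resp. left exact) if there are $\mathbb E$-triangles $A\xrightarrow{f}B\xrightarrow{g_1}K\dashrightarrow$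 and $K\xrightarrow{g_2}C\xrightarrow{h}D\dashrightarrow$ with $g=g_2g_1$ and $g_1$ (resp. $g_2$) compatible. An additive functor $F$ between extriangulated categories is right exact if it preserves compatible morphisms, sends right exact sequences to right exact sequences (so for each $\mathbb E$-triangle $A\xrightarrow{f}B\xrightarrow{g}C\overset{\delta}\dashrightarrow$ there are an $\mathbb E$-triangle $A'\xrightarrow{x}FB\xrightarrow{Fg}FC\dashrightarrow$ and a compatible deflation $y:FA\to A'$ with $Ff=xy$), and the latter $\mathbb E$-triangles are realizations of $\eta(\delta)\in\mathbb E(FC,A')$ for a natural transformation $\eta$; left exact functors are defined dually. $F$ is exact if it preserves compatible morphisms and there is a natural transformation $\eta:\mathbb E(-,-)\Rightarrow\mathbb E(F-,F-)$ with $\mathfrak s(\eta(\delta))=[FA\to FB\to FC]$ whenever $\mathfrak s(\delta)=[A\to B\to C]$. Recollement. A recollement $(\mathcal A,\mathcal B,\mathcal C)$ of extriangulated categories consists of exact functors $i_*:\mathcal A\to\mathcal B$, $j^*:\mathcal B\to\mathcal C$, right exact functors $i^*:\mathcal B\to\mathcal A$, $j_!:\mathcal C\to\mathcal B$ and left exact functors $i^!:\mathcal B\to\mathcal A$, $j_*:\mathcal C\to\mathcal B$ such that: (R1) $(i^*,i_*,i^!)$ and $(j_!,j^*,j_* )$ are adjoint triples; (R2) $\operatorname{Im}i_*=\operatorname{Ker}j^*$; (R3) $i_*,j_!,j_*$ are fully faithful; (R4) for each $B\in\mathcal B$ there is a left exact $\mathbb E$-triangle sequence $i_*i^!(B)\to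 B\to j_*j^*(B)\to i_*(A)$ with $A\in\mathcal A$, the first two maps being adjunction morphisms; (R5) for each $B\in\mathcal B$ there is a right exact $\mathbb E$-triangle sequence $i_*(A')\to j_!j^*(B)\to B\to i_*i^*(B)$ with $A'\in\mathcal A$, the last two maps being adjunction morphisms. *)

(* Defs.v *)
(* Extriangulated categories (Nakaoka-Palu) and their recollements
   (Wang-Wei-Zhang). *)
From HB Require Import structures.
From mathcomp Require Import all_boot all_order all_algebra.
From mathcomp Require Import boolp classical_sets constructive_ereal.

Set Implicit Arguments.
Unset Strict Implicit.
Unset Printing Implicit Defensive.

Import Order.TTheory GRing.Theory Num.Theory.

Local Open Scope classical_set_scope.
Local Open Scope ring_scope.

Record addCat := AddCat {
  Ob :> Type;
  Hom : Ob -> Ob -> zmodType;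
  idm : forall A, Hom A A;
  comp : forall A B C, Hom B C -> Hom A B -> Hom A C;
  compA : forall A B C D (h : Hom C D) (g : Hom B C) (f : Hom A B),
    comp h (comp g f) = comp (comp h g) f;
  comp1m : forall A B (f : Hom A B), comp (idm B) f = f;
  compm1 : forall A B (f : Hom A B), comp f (idm A) = f;
  compDl : forall A B C (g g' : Hom B C) (f : Hom A B),
    comp (g + g') f = comp g f + comp g' f;
  compDr : forall A B C (g : Hom B C) (f f' : Hom A B),
    comp g (f + f') = comp g f + comp g f';
  zob : Ob;
  zob_terminal : forall A (f : Hom A zob), f = 0;
  zob_initial : forall A (f : Hom zob A), f = 0;
  sumob : Ob -> Ob -> Ob;
  bin1 : forall A B, Hom A (sumob A B);
  bin2 : forall A B, Hom B (sumob A B);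
  bpr1 : forall A B, Hom (sumob A B) A;
  bpr2 : forall A B, Hom (sumob A B) B;
  bpr1_bin1 : forall A B, comp (bpr1 A B) (bin1 A B) = idm A;
  bpr2_bin2 : forall A B, comp (bpr2 A B) (bin2 A B) = idm B;
  bpr1_bin2 : forall A B, comp (bpr1 A B) (bin2 A B) = 0;
  bpr2_bin1 : forall A B, comp (bpr2 A B) (bin1 A B) = 0;
  sumob_id : forall A B,
    comp (bin1 A B) (bpr1 A B) + comp (bin2 A B) (bpr2 A B) = idm (sumob A B)
}.

Arguments Hom {a} A B.
Arguments idm {a} A.
Arguments comp {a A B C} g f.
Arguments zob {a}.
Arguments sumob {a} A B.
Arguments bin1 {a} A B.
Arguments bin2 {a} A B.
Arguments bpr1 {a} A B.
Arguments bpr2 {a} A B.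

Declare Scope cat_scope.
Delimit Scope cat_scope with cat.
Notation "g ∘ f" := (comp g f) (at level 40, left associativity) : cat_scope.
Open Scope cat_scope.

Section AdditiveCategories.
Variable C : addCat.

Definition is_iso (A B : C) (f : Hom A B) : Prop :=
  exists g : Hom B A, g ∘ f = idm A /\ f ∘ g = idm B.

Definition isom (A B : C) : Prop := exists f : Hom A B, is_iso f.

Definition is_zero (A : C) : Prop := isom A zob.

Definition summ (A A' B B' : C) (f : Hom A B) (f' : Hom A' B') :
    Hom (sumob A A') (sumob B B') :=
  bin1 B B' ∘ f ∘ bpr1 A A' + bin2 B B' ∘ f' ∘ bpr2 A A'.

Definition seq_equiv (A B B' D : C) (x : Hom A B) (y : Hom B D)
    (x' : Hom A B') (y' : Hom B' D) : Prop :=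
  exists b : Hom B B', [/\ is_iso b, b ∘ x = x' & y' ∘ b = y].

(* Subcategories are full, hence given by their objects. *)
Definition subcategory (X : set C) : Prop :=
  [/\ X zob,
      forall A B, X A -> X B -> X (sumob A B) &
      forall A B, isom A B -> X A -> X B].

End AdditiveCategories.

(* [realizes d x y] states that the sequence (x, y) belongs to the class s(d);
   [realizes_ex] and [realizesP] say that s(d) is exactly one equivalence
   class. The formula in [realizes_sum] for the direct sum of d and d' is the
   element of E(C (+) C', A (+) A') with matrix components (d, 0, 0, d'). *)
Record extriCat := ExtriCat {
  addcat :> addCat;
  E : addcat -> addcat -> zmodType;
  push : forall C A A' : addcat, Hom A A' -> E C A -> E C A';
  pull : forall C C' A : addcat, Hom C' C -> E C A -> E C' A;
  pushD : forall C A A' (a : Hom A A') (d d' : E C A),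
    push a (d + d') = push a d + push a d';
  pullD : forall C C' A (c : Hom C' C) (d d' : E C A),
    pull c (d + d') = pull c d + pull c d';
  push_id : forall C A (d : E C A), push (idm A) d = d;
  pull_id : forall C A (d : E C A), pull (idm C) d = d;
  push_comp : forall C A A' A'' (a' : Hom A' A'') (a : Hom A A') (d : E C A),
    push (a' ∘ a) d = push a' (push a d);
  pull_comp : forall C C' C'' A (c : Hom C' C) (c' : Hom C'' C') (d : E C A),
    pull (c ∘ c') d = pull c' (pull c d);
  push_pull : forall C C' A A' (a : Hom A A') (c : Hom C' C) (d : E C A),
    push a (pull c d) = pull c (push a d);
  push_addm : forall C A A' (a a' : Hom A A') (d : E C A),
    push (a + a') d = push a d + push a' d;
  pull_addm : forall C C' A (c c' : Hom C' C) (d : E C A),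
    pull (c + c') d = pull c d + pull c' d;
  realizes : forall A B C : addcat, E C A -> Hom A B -> Hom B C -> Prop;
  realizes_ex : forall A C (d : E C A),
    exists (B : addcat) (x : Hom A B) (y : Hom B C), realizes d x y;
  realizesP : forall A C (d : E C A) B (x : Hom A B) (y : Hom B C)
      B' (x' : Hom A B') (y' : Hom B' C),
    realizes d x y -> (realizes d x' y' <-> seq_equiv x y x' y');
  realizes_mor : forall A B C A' B' C' (d : E C A) (d' : E C' A')
      (x : Hom A B) (y : Hom B C) (x' : Hom A' B') (y' : Hom B' C')
      (a : Hom A A') (c : Hom C C'),
    realizes d x y -> realizes d' x' y' -> push a d = pull c d' ->
    exists b : Hom B B', b ∘ x = x' ∘ a /\ y' ∘ b = c ∘ y;
  realizes0 : forall A C, realizes (0 : E C A) (bin1 A C) (bpr2 A C);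
  realizes_sum : forall A B C A' B' C' (d : E C A) (d' : E C' A')
      (x : Hom A B) (y : Hom B C) (x' : Hom A' B') (y' : Hom B' C'),
    realizes d x y -> realizes d' x' y' ->
    realizes (push (bin1 A A') (pull (bpr1 C C') d)
              + push (bin2 A A') (pull (bpr2 C C') d'))
             (summ x x') (summ y y');
  ET3 : forall A B C A' B' C' (d : E C A) (d' : E C' A')
      (x : Hom A B) (y : Hom B C) (x' : Hom A' B') (y' : Hom B' C')
      (a : Hom A A') (b : Hom B B'),
    realizes d x y -> realizes d' x' y' -> b ∘ x = x' ∘ a ->
    exists c : Hom C C', c ∘ y = y' ∘ b /\ push a d = pull c d';
  ET3op : forall A B C A' B' C' (d : E C A) (d' : E C' A')
      (x : Hom A B) (y : Hom B C) (x' : Hom A' B') (y' : Hom B' C')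
      (b : Hom B B') (c : Hom C C'),
    realizes d x y -> realizes d' x' y' -> c ∘ y = y' ∘ b ->
    exists a : Hom A A', b ∘ x = x' ∘ a /\ push a d = pull c d';
  ET4 : forall A B C D F (f : Hom A B) (f' : Hom B D) (d1 : E D A)
      (g : Hom B C) (g' : Hom C F) (d2 : E F B),
    realizes d1 f f' -> realizes d2 g g' ->
    exists (G : addcat) (d3 : E G A) (h' : Hom C G) (u : Hom D G) (v : Hom G F),
      realizes d3 (g ∘ f) h'
      /\ u ∘ f' = h' ∘ g /\ v ∘ h' = g'
      /\ realizes (push f' d2) u v
      /\ pull u d3 = d1 /\ push f d3 = pull v d2;
  ET4op : forall D A B F C (f' : Hom D A) (f : Hom A B) (d1 : E B D)
      (g' : Hom F B) (g : Hom B C) (d2 : E C F),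
    realizes d1 f' f -> realizes d2 g' g ->
    exists (G : addcat) (d3 : E C G) (h' : Hom G A) (u : Hom D G) (v : Hom G F),
      realizes d3 h' (g ∘ f)
      /\ h' ∘ u = f' /\ f ∘ h' = g' ∘ v
      /\ realizes (pull g' d1) u v
      /\ push v d3 = d2 /\ push u d1 = pull g d3
}.

Arguments E {e} C A.
Arguments push {e C A A'} a d.
Arguments pull {e C C' A} c d.
Arguments realizes {e A B C} d x y.

Section Extriangulated.
Variable C : extriCat.

Definition etriangle (X Y Z : C) (x : Hom X Y) (y : Hom Y Z) : Prop :=
  exists d : E Z X, realizes d x y.

Definition inflation (X Y : C) (x : Hom X Y) : Prop :=
  exists (Z : C) (y : Hom Y Z), etriangle x y.

Definition deflation (Y Z : C) (y : Hom Y Z) : Prop :=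
  exists (X : C) (x : Hom X Y), etriangle x y.

Definition WIC : Prop :=
  (forall (X Y Z : C) (f : Hom X Y) (g : Hom Y Z),
     inflation (g ∘ f) -> inflation f)
  /\ (forall (X Y Z : C) (f : Hom X Y) (g : Hom Y Z),
     deflation (g ∘ f) -> deflation g).

Definition projective (P : C) : Prop :=
  forall (Y Z : C) (y : Hom Y Z), deflation y ->
  forall f : Hom P Z, exists g : Hom P Y, y ∘ g = f.

Definition injective_ob (I : C) : Prop :=
  forall (X Y : C) (x : Hom X Y), inflation x ->
  forall f : Hom X I, exists g : Hom Y I, g ∘ x = f.

Definition is_syzygy (M K : C) : Prop :=
  exists (P : C) (x : Hom K P) (y : Hom P M), projective P /\ etriangle x y.

Definition is_cosyzygy (M K : C) : Prop :=
  exists (I : C) (x : Hom M I) (y : Hom I K), injective_ob I /\ etriangle x y.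

Definition enough_projectives : Prop := forall M, exists K, is_syzygy M K.

Definition enough_injectives : Prop := forall M, exists K, is_cosyzygy M K.

Definition compatible (X Y : C) (f : Hom X Y) : Prop :=
  inflation f -> deflation f -> is_iso f.

Definition right_exact_seq (X Y Z : C) (f : Hom X Y) (g : Hom Y Z) : Prop :=
  exists (K : C) (h2 : Hom K Y) (h1 : Hom X K),
    [/\ etriangle h2 g, compatible h1, deflation h1 & f = h2 ∘ h1].

Definition left_exact_seq (X Y Z : C) (f : Hom X Y) (g : Hom Y Z) : Prop :=
  exists (K : C) (h2 : Hom Y K) (h1 : Hom K Z),
    [/\ etriangle f h2, compatible h1, inflation h1 & g = h1 ∘ h2].

Definition right_exact_seq4 (X Y Z W : C)
    (f : Hom X Y) (g : Hom Y Z) (h : Hom Z W) : Prop :=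
  exists (K : C) (g1 : Hom Y K) (g2 : Hom K Z),
    [/\ etriangle f g1, etriangle g2 h, g = g2 ∘ g1 & compatible g1].

Definition left_exact_seq4 (X Y Z W : C)
    (f : Hom X Y) (g : Hom Y Z) (h : Hom Z W) : Prop :=
  exists (K : C) (g1 : Hom Y K) (g2 : Hom K Z),
    [/\ etriangle f g1, etriangle g2 h, g = g2 ∘ g1 & compatible g2].

(* The E-triangle sequence 0 -> Y_0 -> ... -> Y_N -> 0, written with increasing
   indices: Y_i sits in an E-triangle K_i -> Y_i -> K_(i+1). The end terms K_0
   and K_(N+1) have to be zero: E-triangles K -> 0 -> K' do not force K = 0 or
   K' = 0 (for instance in a triangulated category). *)
Definition etriangle_seq (N : nat) (Y : nat -> C)
    (d : forall i, Hom (Y i) (Y i.+1)) : Prop :=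
  exists (K : nat -> C) (g : forall i, Hom (K i) (Y i))
         (f : forall i, Hom (Y i) (K i.+1)),
    [/\ is_zero (K 0%N), is_zero (K N.+1),
        forall i, (i <= N)%N -> etriangle (g i) (f i) &
        forall i, (i < N)%N -> d i = g i.+1 ∘ f i].

(* 0 -> M -> X_0 -> ... -> X_n -> 0, with X_i = Y_(i+1). *)
Definition coresolution (X : set C) (M : C) (n : nat) : Prop :=
  exists (Y : nat -> C) (d : forall i, Hom (Y i) (Y i.+1)),
    [/\ Y 0%N = M, forall i, (i <= n)%N -> X (Y i.+1) & etriangle_seq n.+1 d].

(* Dimensions lie in the part N u {+oo} of the extended integers. *)
Definition cores_dim (X : set C) (M : C) : \bar int :=
  infimum +oo%E [set n%:Z%:E | n in [set n | coresolution X M n]].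

Definition cores_dim_class (X S : set C) : \bar int :=
  supremum 0%E [set cores_dim X M | M in S].

End Extriangulated.

(* Extriangulated categories with the standing assumptions. *)
Record stdExtriCat := StdExtriCat {
  extricat :> extriCat;
  std_WIC : WIC extricat;
  std_projectives : enough_projectives extricat;
  std_injectives : enough_injectives extricat
}.

Section HigherExtensions.
Variable C : stdExtriCat.

Definition Omega (M : C) : C := sval (cid (std_projectives M)).

(* E^(k+1)(M, N) = E(Omega^k M, N); the value at k = 0 is meaningless. *)
Definition Ek (k : nat) (M N : C) : zmodType := E (iter k.-1 Omega M) N.

Definition perp (X : set C) : set C :=
  [set M | forall k, (1 <= k)%N -> forall Y, X Y ->
           forall d : Ek k Y M, d = 0].

End HigherExtensions.

Record addFun (C D : addCat) := AddFun {
  fob :> C -> D;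
  fmap : forall X Y : C, Hom X Y -> Hom (fob X) (fob Y);
  fmap_id : forall X, fmap (idm X) = idm (fob X);
  fmap_comp : forall (X Y Z : C) (g : Hom Y Z) (f : Hom X Y),
    fmap (g ∘ f) = fmap g ∘ fmap f;
  fmapD : forall (X Y : C) (f g : Hom X Y), fmap (f + g) = fmap f + fmap g
}.

Arguments fmap {C D} F {X Y} f : rename.

Definition fimage (C D : addCat) (F : addFun C D) (X : set C) : set D :=
  [set N | exists2 M, X M & isom (F M) N].

Definition fully_faithful (C D : addCat) (F : addFun C D) : Prop :=
  forall X Y : C, bijective (fun f : Hom X Y => fmap F f).

Record adjunction (C D : addCat) (L : addFun C D) (R : addFun D C) :=
  Adjunction {
  unit_ : forall X : C, Hom X (R (L X));
  counit_ : forall Y : D, Hom (L (R Y)) Y;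
  unit_nat : forall (X X' : C) (f : Hom X X'),
    fmap R (fmap L f) ∘ unit_ X = unit_ X' ∘ f;
  counit_nat : forall (Y Y' : D) (g : Hom Y Y'),
    g ∘ counit_ Y = counit_ Y' ∘ fmap L (fmap R g);
  triangleL : forall X : C, counit_ (L X) ∘ fmap L (unit_ X) = idm (L X);
  triangleR : forall Y : D, fmap R (counit_ Y) ∘ unit_ (R Y) = idm (R Y)
}.

Section Exactness.
Variables (C D : extriCat) (F : addFun C D).

Definition preserves_compatible : Prop :=
  forall (X Y : C) (f : Hom X Y), compatible f -> compatible (fmap F f).

Definition exact_functor : Prop :=
  preserves_compatible
  /\ exists eta : forall Z X : C, {additive E Z X -> E (F Z) (F X)},
     [/\ forall (Z X X' : C) (a : Hom X X') (d : E Z X),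
           eta Z X' (push a d) = push (fmap F a) (eta Z X d),
         forall (Z Z' X : C) (c : Hom Z' Z) (d : E Z X),
           eta Z' X (pull c d) = pull (fmap F c) (eta Z X d) &
         forall (X Y Z : C) (d : E Z X) (x : Hom X Y) (y : Hom Y Z),
           realizes d x y -> realizes (eta Z X d) (fmap F x) (fmap F y)].

(* The object X'_d and the deflation y_d : F X -> X'_d depend on the extension
   d, so naturality of eta is naturality on the category of extensions: every
   morphism (a, c) : d -> d' induces some a' : X'_d -> X'_d' compatible with
   y_d, y_d' such that (a', F c) is a morphism from eta(d) to eta(d'). *)
Definition right_exact_functor : Prop :=
  [/\ preserves_compatible,
      forall (X Y Z : C) (f : Hom X Y) (g : Hom Y Z),
        right_exact_seq f g -> right_exact_seq (fmap F f) (fmap F g) &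
      exists (X' : forall Z X : C, E Z X -> D)
             (y : forall (Z X : C) (d : E Z X), Hom (F X) (X' Z X d))
             (eta : forall (Z X : C) (d : E Z X), E (F Z) (X' Z X d)),
        (forall (X Y Z : C) (d : E Z X) (f : Hom X Y) (g : Hom Y Z),
           realizes d f g ->
           exists x : Hom (X' Z X d) (F Y),
             [/\ realizes (eta Z X d) x (fmap F g), compatible (y Z X d),
                 deflation (y Z X d) & fmap F f = x ∘ y Z X d])
        /\ (forall (Z1 X1 Z2 X2 : C) (d1 : E Z1 X1) (d2 : E Z2 X2)
              (a : Hom X1 X2) (c : Hom Z1 Z2),
           push a d1 = pull c d2 ->
           exists a' : Hom (X' Z1 X1 d1) (X' Z2 X2 d2),
             a' ∘ y Z1 X1 d1 = y Z2 X2 d2 ∘ fmap F a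
             /\ push a' (eta Z1 X1 d1) = pull (fmap F c) (eta Z2 X2 d2))].

Definition left_exact_functor : Prop :=
  [/\ preserves_compatible,
      forall (X Y Z : C) (f : Hom X Y) (g : Hom Y Z),
        left_exact_seq f g -> left_exact_seq (fmap F f) (fmap F g) &
      exists (Z' : forall Z X : C, E Z X -> D)
             (y : forall (Z X : C) (d : E Z X), Hom (Z' Z X d) (F Z))
             (eta : forall (Z X : C) (d : E Z X), E (Z' Z X d) (F X)),
        (forall (X Y Z : C) (d : E Z X) (f : Hom X Y) (g : Hom Y Z),
           realizes d f g ->
           exists x : Hom (F Y) (Z' Z X d),
             [/\ realizes (eta Z X d) (fmap F f) x, compatible (y Z X d),
                 inflation (y Z X d) & fmap F g = y Z X d ∘ x])
        /\ (forall (Z1 X1 Z2 X2 : C) (d1 : E Z1 X1) (d2 : E Z2 X2)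
              (a : Hom X1 X2) (c : Hom Z1 Z2),
           push a d1 = pull c d2 ->
           exists c' : Hom (Z' Z1 X1 d1) (Z' Z2 X2 d2),
             y Z2 X2 d2 ∘ c' = fmap F c ∘ y Z1 X1 d1
             /\ push (fmap F a) (eta Z1 X1 d1) = pull c' (eta Z2 X2 d2))].

End Exactness.

(* The six functors i_* = iL, i^* = iU, i^! = iUs, j_! = jLs, j^* = jU and
   j_* = jL (L: lower, U: upper, s: shriek). *)
Record recollement (A B C : stdExtriCat) := Recollement {
  iL : addFun A B;
  iU : addFun B A;
  iUs : addFun B A;
  jU : addFun B C;
  jLs : addFun C B;
  jL : addFun C B;
  iL_exact : exact_functor iL;
  jU_exact : exact_functor jU;
  iU_right_exact : right_exact_functor iU;
  jLs_right_exact : right_exact_functor jLs;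
  iUs_left_exact : left_exact_functor iUs;
  jL_left_exact : left_exact_functor jL;
  adj_iU_iL : adjunction iU iL;
  adj_iL_iUs : adjunction iL iUs;
  adj_jLs_jU : adjunction jLs jU;
  adj_jU_jL : adjunction jU jL;
  im_ker : forall M : B, fimage iL setT M <-> is_zero (jU M);
  iL_ff : fully_faithful iL;
  jLs_ff : fully_faithful jLs;
  jL_ff : fully_faithful jL;
  left_seq : forall M : B, exists (N : A) (h : Hom (jL (jU M)) (iL N)),
    left_exact_seq4 (counit_ adj_iL_iUs M) (unit_ adj_jU_jL M) h;
  right_seq : forall M : B, exists (N : A) (h : Hom (iL N) (jLs (jU M))),
    right_exact_seq4 h (counit_ adj_jLs_jU M) (unit_ adj_iU_iL M)
}.

(* Main.v *)
From mathcomp Require Import all_boot all_order all_algebra.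
From mathcomp Require Import boolp classical_sets constructive_ereal.
From mathcomp Require Import zify.
Require Import Defs.

Set Implicit Arguments.
Unset Strict Implicit.
Unset Printing Implicit Defensive.

Import Order.TTheory GRing.Theory Num.Theory.

Local Open Scope classical_set_scope.

(** The eight inequalities are dimension shifting, once coresolution dimension
    is expressed by vanishing of extensions.

    Say that M has ext-dimension at most n ([ext_dim_le]) when E^k(Y, M) = 0
    for all k > n and all Y in X. The long exact sequence of an E-triangle
    M -> N -> L bounds the ext-dimension of each term by those of the other two
    ([ext_dim_le_mid], [ext_dim_le_right], [ext_dim_le_left]). Only the
    vanishing consequences of that sequence occur; they follow from its
    five-term pieces, written for single extensions in the first part, by using
    the triangle Omega W -> P -> W to pass from E(Omega W, -) to E(W, -).
    Embedding M in an injective lowers its ext-dimension by one, so that M has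
    an X^perp-coresolution of length n exactly when its ext-dimension is at most
    n ([coresolution_perp]). Hence a bound on the coresolution dimension of an
    object can be proved by induction on injective embeddings
    ([ext_dim_le_ind]), without handling coresolutions.

    An exact functor F carries E-triangles to E-triangles, so if F sends X^perp
    to objects of dimension at most q, it sends objects of dimension at most n
    to objects of dimension at most n + q ([exact_ext_dim_le]). With F equal to
    i_*, j^* and i^! this yields (2), (4) and (7), since every object of A is
    isomorphic to some i^!(B) and every object of C to some j^*(B).

    For (1), j_* is only left exact: a triangle U -> V -> W gives a triangle
    j_*U -> j_*V -> W' together with an inflation W' -> j_*W. The functor j^*
    turns this inflation into an isomorphism, by compatibility and WIC, so its
    cone lies in the image of i_* ([jL_triangle]). This costs one extra
    dimension, but only once: the estimate n + m + 1 for j_*U, where m bounds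
    the dimensions on i_*(A) and on j_*(X''^perp), is stable under the induction
    ([ext_dim_le_jL]). The sequence of (R4) then bounds the dimension of an
    object M of B by that of j_*j^*M ([ext_dim_le_gluing]). The other parts are
    arithmetic consequences of these. *)

(** * Exact sequences attached to an E-triangle *)

Section ExactSequences.
Local Open Scope ring_scope.
Context {C : extriCat}.

Lemma comp0m (X Y Z : C) (f : Hom X Y) : (0 : Hom Y Z) ∘ f = 0.
Proof. by apply: (addrI (0 ∘ f)); rewrite -compDl !addr0. Qed.

Lemma compm0 (X Y Z : C) (g : Hom Y Z) : g ∘ (0 : Hom X Y) = 0.
Proof. by apply: (addrI (g ∘ 0)); rewrite -compDr !addr0. Qed.

Lemma push0 (Z X X' : C) (a : Hom X X') : push a (0 : E Z X) = 0.
Proof. by apply: (addrI (push a 0)); rewrite -pushD !addr0. Qed.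

Lemma pull0 (Z Z' X : C) (c : Hom Z' Z) : pull c (0 : E Z X) = 0.
Proof. by apply: (addrI (pull c 0)); rewrite -pullD !addr0. Qed.

Lemma push_zero (Z X X' : C) (d : E Z X) : push (0 : Hom X X') d = 0.
Proof. by apply: (addrI (push 0 d)); rewrite -push_addm !addr0. Qed.

Lemma pull_zero (Z Z' X : C) (d : E Z X) : pull (0 : Hom Z' Z) d = 0.
Proof. by apply: (addrI (pull 0 d)); rewrite -pull_addm !addr0. Qed.

Lemma is_iso_id (X : C) : is_iso (idm X).
Proof. by exists (idm X); rewrite comp1m. Qed.

Lemma isom_refl (X : C) : isom X X.
Proof. by exists (idm X); exact: is_iso_id. Qed.

Lemma isom_sym (X Y : C) : isom X Y -> isom Y X.
Proof. by case=> f [g [gf fg]]; exists g, f. Qed.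

Lemma is_zero_idm (X : C) : is_zero X <-> idm X = 0.
Proof.
split=> [[f [g [gf _]]]|X0].
  by rewrite -gf (zob_terminal f) compm0.
by exists 0, 0; rewrite !compm0; split; rewrite ?X0 // (zob_terminal (idm zob)).
Qed.

Lemma is_zero_zob : is_zero (zob : C).
Proof. by apply/is_zero_idm; exact: zob_terminal. Qed.

Lemma is_zero_ext (Z X : C) (d : E Z X) : is_zero X -> d = 0.
Proof. by move/is_zero_idm=> X0; rewrite -(push_id d) X0 push_zero. Qed.

Lemma realizes_equiv (X Y Y' Z : C) (d : E Z X) (x : Hom X Y) (y : Hom Y Z)
    (x' : Hom X Y') (y' : Hom Y' Z) :
  seq_equiv x y x' y' -> realizes d x y -> realizes d x' y'.
Proof. by move=> xy dxy; apply/(realizesP x' y' dxy). Qed.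

(** Up to the isomorphism X + 0 -> X -> Y, this is the split triangle on X
    and 0. *)
Lemma realizes0_iso_zero (X Y : C) (f : Hom X Y) :
  is_iso f -> realizes (0 : E zob X) f 0.
Proof.
case=> g [gf fg]; apply: realizes_equiv (realizes0 X zob).
have p0 : bpr2 X zob = 0 by apply: zob_terminal.
exists (f ∘ bpr1 X zob); split.
- exists (bin1 X zob ∘ g); split.
    by rewrite compA -(compA _ g f) gf compm1 -(sumob_id X zob) p0 compm0 addr0.
  by rewrite compA -(compA f) bpr1_bin1 compm1.
- by rewrite -compA bpr1_bin1 compm1.
- by rewrite comp0m p0.
Qed.

Lemma realizes0_zero_iso (X Y : C) (f : Hom X Y) :
  is_iso f -> realizes (0 : E Y zob) 0 f.
Proof.
case=> g [gf fg]; apply: realizes_equiv (realizes0 zob Y).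
have i0 : bin1 zob Y = 0 by apply: zob_initial.
exists (g ∘ bpr2 zob Y); split.
- exists (bin2 zob Y ∘ f); split.
    by rewrite compA -(compA _ f g) fg compm1 -(sumob_id zob Y) i0 comp0m add0r.
  by rewrite compA -(compA g) bpr2_bin2 compm1.
- by rewrite i0 compm0.
- by rewrite compA fg comp1m.
Qed.

Lemma iso_deflation (X Y : C) (f : Hom X Y) : is_iso f -> deflation f.
Proof. by move=> /realizes0_zero_iso f0; exists zob, 0, 0. Qed.

Lemma deflation_comp (X Y Z : C) (f : Hom X Y) (g : Hom Y Z) :
  deflation f -> deflation g -> deflation (g ∘ f).
Proof.
move=> [K [k [d df]]] [L [l [e eg]]].
have [G [d3 [h [_ [_ [d3h _]]]]]] := ET4op df eg.
by exists G, h, d3.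
Qed.

(** Compare X -> X -> 0 with the given triangle along x: the induced morphism
    0 -> Z makes y x factor through 0. *)
Lemma realizes_comp0 (X Y Z : C) (d : E Z X) (x : Hom X Y) (y : Hom Y Z) :
  realizes d x y -> y ∘ x = 0.
Proof.
move=> dxy.
have [//|c [<- _]] := ET3 (a := idm X) (b := x) (realizes0_iso_zero (is_iso_id X)) dxy.
exact: compm0.
Qed.

Section Triangle.
Variables (X Y Z : C) (d : E Z X) (x : Hom X Y) (y : Hom Y Z).
Hypothesis dxy : realizes d x y.

(** The morphism (x, 1) : X + Y -> Y lies over y, so the split extension of Y
    by X maps to d over y; hence the pullback of d along y is a pushout of
    0. *)
Lemma pull_deflation0 : pull y d = 0.
Proof.
pose b : Hom (sumob X Y) Y := x ∘ bpr1 X Y + bpr2 X Y.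
have [|a [_ <-]] := ET3op (b := b) (c := y) (realizes0 X Y) dxy.
  by rewrite /b compDr compA (realizes_comp0 dxy) comp0m add0r.
exact: push0.
Qed.

Lemma push_inflation0 : push x d = 0.
Proof.
pose b : Hom Y (sumob Y Z) := bin1 Y Z + bin2 Y Z ∘ y.
have [|c [_ ->]] := ET3 (a := x) (b := b) dxy (realizes0 Y Z).
  by rewrite /b compDl -compA (realizes_comp0 dxy) compm0 addr0.
exact: pull0.
Qed.

(** A morphism from the split extension to d lying over f is, on the summand
    W, a lift of f. *)
Lemma lift_of_pull0 (W : C) (f : Hom W Z) :
  pull f d = 0 -> exists g : Hom W Y, y ∘ g = f.
Proof.
move=> f0.
have [|b [_ yb]] := realizes_mor (a := idm X) (c := f) (realizes0 X W) dxy.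
  by rewrite push0 f0.
by exists (b ∘ bin2 X W); rewrite compA yb -compA bpr2_bin2 compm1.
Qed.

Lemma extend_of_push0 (W : C) (f : Hom X W) :
  push f d = 0 -> exists g : Hom Y W, g ∘ x = f.
Proof.
move=> f0.
have [|b [bx _]] := realizes_mor (a := f) (c := idm Z) dxy (realizes0 W Z).
  by rewrite pull0.
by exists (bpr1 W Z ∘ b); rewrite -compA bx compA bpr1_bin1 comp1m.
Qed.

End Triangle.

(** Exactness of Hom(W, Z) -> E(W, X) -> E(W, Y) at the middle: x extends to
    the middle term of a realization of t, and (ET3) completes this extension
    to a morphism from t to d. *)
Lemma pull_of_push0 (X Y Z W : C) (d : E Z X) (x : Hom X Y) (y : Hom Y Z)
    (t : E W X) :
  realizes d x y -> push x t = 0 -> exists f : Hom W Z, t = pull f d.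
Proof.
move=> dxy xt0; have [T [u [v tuv]]] := realizes_ex t.
have [g gu] := extend_of_push0 tuv xt0.
have [|f [_ tf]] := ET3 (a := idm X) (b := g) tuv dxy; first by rewrite compm1.
by exists f; rewrite -tf push_id.
Qed.

(** Exactness of Hom(X, W) -> E(Z, W) -> E(Y, W) at the middle, dual to
    [pull_of_push0]. *)
Lemma push_of_pull0 (X Y Z W : C) (d : E Z X) (x : Hom X Y) (y : Hom Y Z)
    (t : E Z W) :
  realizes d x y -> pull y t = 0 -> exists f : Hom X W, t = push f d.
Proof.
move=> dxy ty0; have [T [u [v tuv]]] := realizes_ex t.
have [g vg] := lift_of_pull0 tuv ty0.
have [|f [_ ft]] := ET3op (b := g) (c := idm Z) dxy tuv; first by rewrite comp1m.
by exists f; rewrite ft pull_id.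
Qed.

(** Exactness of E(W, X) -> E(W, Y) -> E(W, Z) at the middle. The composite of
    x with the inflation of t has, by (ET4), a cone G which is an extension of
    W by Z of class y_* t = 0; a section W -> G pulls the class of the composite
    back to a preimage of t. *)
Lemma push_of_push0 (X Y Z W : C) (d : E Z X) (x : Hom X Y) (y : Hom Y Z)
    (t : E W Y) :
  realizes d x y -> push y t = 0 -> exists s : E W X, t = push x s.
Proof.
move=> dxy yt0; have [T [g [g' tgg]]] := realizes_ex t.
have [G [d3 [h [u [v [_ [_ [_ [uv [_ pd3]]]]]]]]]] := ET4 dxy tgg.
have [s vs] : exists s : Hom W G, v ∘ s = idm W.
  by apply: (lift_of_pull0 uv); rewrite yt0 pull0.
by exists (pull s d3); rewrite push_pull pd3 -pull_comp vs pull_id.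
Qed.

Lemma projective_ext (P X : C) (d : E P X) : projective P -> d = 0.
Proof.
move=> projP; have [Y [x [y dxy]]] := realizes_ex d.
have [|s ys] := projP _ _ y _ (idm P); first by exists X, x, d.
by rewrite -(pull_id d) -ys pull_comp (pull_deflation0 dxy) pull0.
Qed.

Lemma injective_ext (Z I : C) (d : E Z I) : injective_ob I -> d = 0.
Proof.
move=> injI; have [Y [x [y dxy]]] := realizes_ex d.
have [|r rx] := injI _ _ x _ (idm I); first by exists Z, y, d.
by rewrite -(push_id d) -rx push_comp (push_inflation0 dxy) push0.
Qed.

Lemma cone_of_iso (X Y Z : C) (x : Hom X Y) (y : Hom Y Z) :
  is_iso x -> etriangle x y -> is_zero Z.
Proof.
move=> [z [zx xz]] [d dxy]; apply/is_zero_idm.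
have y0 : y = 0 by rewrite -(compm1 y) -xz compA (realizes_comp0 dxy) comp0m.
have d0 : d = 0.
  by rewrite -(push_id d) -zx push_comp (push_inflation0 dxy) push0.
have [|s <-] := lift_of_pull0 dxy (f := idm Z); first by rewrite d0 pull0.
by rewrite y0 comp0m.
Qed.

End ExactSequences.

(** * Coresolution dimension as vanishing of extensions *)

Section Dimension.
Local Open Scope ring_scope.
Variables (C : stdExtriCat) (X : set C).

(** For n = 0 this is by definition [perp X]. *)
Definition ext_dim_le (n : nat) : set C :=
  [set M | forall k, (n < k)%N -> forall Y, X Y ->
           forall d : Ek k Y M, d = 0].

Lemma ext_dim_le_mono n m M : (n <= m)%N -> ext_dim_le n M -> ext_dim_le m M.
Proof. by move=> nm nM k mk; apply: nM; exact: leq_ltn_trans mk. Qed.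

Lemma ext_dim_le_isom n M N : isom M N -> ext_dim_le n M -> ext_dim_le n N.
Proof.
move=> [f [g [_ fg]]] nM k nk Y XY d.
by rewrite -(push_id d) -fg push_comp (nM k nk Y XY (push g d)) push0.
Qed.

Lemma ext_dim_le_zero n M : is_zero M -> ext_dim_le n M.
Proof. by move=> M0 k _ Y _ d; exact: is_zero_ext. Qed.

Lemma ext_dim_le_injective n I : injective_ob I -> ext_dim_le n I.
Proof. by move=> injI k _ Y _ d; exact: injective_ext. Qed.

Lemma Omega_triangle (W : C) : exists (P : C) (k : Hom (Omega W) P)
  (p : Hom P W) (w : E W (Omega W)), projective P /\ realizes w k p.
Proof.
by rewrite /Omega; case: cid => K /= [P [k [p [projP [w wkp]]]]]; exists P, k, p, w.
Qed.

Section Triangle.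
Variables (M N L : C) (x : Hom M N) (y : Hom N L).
Hypothesis xy : etriangle x y.

Lemma ext_dim_le_mid n : ext_dim_le n M -> ext_dim_le n L -> ext_dim_le n N.
Proof.
move=> nM nL k nk Y XY t; have [d dxy] := xy.
have [s ->] := push_of_push0 dxy (nL k nk Y XY (push y t)).
by rewrite (nM k nk Y XY s) push0.
Qed.

(** E(W, N) -> E(W, L) -> E(Omega W, M) is exact at the middle: an extension of
    W by L is pushed out from Omega W along some f : Omega W -> L, whose
    connecting class f^* d is the obstruction to lifting f to N. *)
Lemma ext_dim_le_right n :
  ext_dim_le n N -> ext_dim_le n.+1 M -> ext_dim_le n L.
Proof.
move=> nN nM [//|k] nk Y XY t; have [d dxy] := xy.
have [P [i [p [w [projP wip]]]]] := Omega_triangle (iter k (@Omega C) Y).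
have [f ->] := push_of_pull0 wip (projective_ext (pull p t) projP).
have [g <-] := lift_of_pull0 dxy (nM k.+2 nk Y XY (pull f d)).
by rewrite push_comp (nN k.+1 nk Y XY (push g w)) push0.
Qed.

(** E(W, L) -> E(Omega W, M) -> E(Omega W, N) is exact at the middle: a class
    killed in N is f^* d for some f : Omega W -> L, and it vanishes if f extends
    to the projective P, the obstruction to which lies in E(W, L). The argument
    needs a class of degree at least 2, whence the successor in the bound for
    M. *)
Lemma ext_dim_le_left n :
  ext_dim_le n.+1 N -> ext_dim_le n L -> ext_dim_le n.+1 M.
Proof.
move=> nN nL [//|[//|k]] nk Y XY t; have [d dxy] := xy.
have [P [i [p [w [projP wip]]]]] := Omega_triangle (iter k (@Omega C) Y).
have [f ->] := pull_of_push0 dxy (nN k.+2 nk Y XY (push x t)).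
have [g <-] := extend_of_push0 wip (nL k.+1 nk Y XY (push f w)).
by rewrite pull_comp (projective_ext (pull g d) projP) pull0.
Qed.

(** For L = 0 the bound of [ext_dim_le_left] improves by one, which matters at
    the end of a coresolution. *)
Lemma ext_dim_le_cone_zero n : is_zero L -> ext_dim_le n N -> ext_dim_le n M.
Proof.
move=> /is_zero_idm L0 nN k nk Y XY t; have [d dxy] := xy.
have [f ->] := pull_of_push0 dxy (nN k nk Y XY (push x t)).
by rewrite -(comp1m f) L0 comp0m pull_zero.
Qed.

End Triangle.

(** The triangle M -> I -> N is an injective embedding of M; N is one step
    shorter by [ext_dim_le_right]. *)
Lemma ext_dim_le_ind (Q : nat -> C -> Prop) :
  (forall M, perp X M -> Q 0%N M) ->
  (forall n (M I N : C) (x : Hom M I) (y : Hom I N),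
     etriangle x y -> perp X I -> Q n N -> Q n.+1 M) ->
  forall n M, ext_dim_le n M -> Q n M.
Proof.
move=> Q0 QS; elim=> [//|n IHn] M nM.
have [N [I [x [y [injI xy]]]]] := std_injectives M.
apply: (QS _ _ _ _ _ _ xy (ext_dim_le_injective (n := 0) injI)); apply: IHn.
exact: (ext_dim_le_right xy (ext_dim_le_injective injI) nM).
Qed.

Lemma zero_triangle (M : C) : etriangle (0 : Hom zob M) (idm M).
Proof. by exists 0; exact: realizes0_zero_iso (is_iso_id M). Qed.

Lemma triangle_zero (M : C) : etriangle (idm M) (0 : Hom M zob).
Proof. by exists 0; exact: realizes0_iso_zero (is_iso_id M). Qed.

(** A coresolution cut at M, that is without the initial triangle 0 -> M -> M.
    In this form it can be extended to the left by a further triangle. Here n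
    counts the triangles, so it exceeds the length of the coresolution by
    one. *)
Definition coresolution_tail (n : nat) (M : C) : Prop :=
  exists (K Y : nat -> C) (g : forall i, Hom (K i) (Y i))
         (f : forall i, Hom (Y i) (K i.+1)),
    [/\ K 0%N = M, is_zero (K n) &
        forall i, (i < n)%N -> perp X (Y i) /\ etriangle (g i) (f i)].

Lemma coresolution_tail_cons n (M I N : C) (x : Hom M I) (y : Hom I N) :
  etriangle x y -> perp X I -> coresolution_tail n N ->
  coresolution_tail n.+1 M.
Proof.
move=> xy XI [K [Y [g [f [K0 Kn KY]]]]]; subst N.
pose K' i := if i is j.+1 then K j else M.
pose Y' i := if i is j.+1 then Y j else I.
pose g' i : Hom (K' i) (Y' i) := if i is j.+1 then g j else x.
pose f' i : Hom (Y' i) (K' i.+1) := if i is j.+1 then f j else y.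
by exists K', Y', g', f'; split=> //; case=> [_|i /KY].
Qed.

Lemma ext_dim_le_coresolution_tail n M :
  ext_dim_le n M -> coresolution_tail n.+1 M.
Proof.
move: n M; apply: ext_dim_le_ind => [M XM|n M I N x y].
  apply: (coresolution_tail_cons (triangle_zero M)) => //.
  exists (fun=> zob), (fun=> zob), (fun=> 0), (fun=> 0); split=> //.
  exact: is_zero_zob.
exact: coresolution_tail_cons.
Qed.

Lemma coresolution_perp n M : coresolution (perp X) M n <-> ext_dim_le n M.
Proof.
split=> [[Y [d [<- XY [K [g [f [K0 Kn KY _]]]]]]]|].
  (* K_(i+1) is the i-th cosyzygy of M; it has n - i steps left. *)
  suff nK j i : (i + j = n)%N -> ext_dim_le j (K i.+1).
    by apply: (ext_dim_le_mid (KY 0%N _)) (nK n 0%N _) => //; exact: ext_dim_le_zero.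
  elim: j i => [|j IHj] i ijn.
    have ni : i = n by lia.
    by subst i; apply: (ext_dim_le_cone_zero (KY n.+1 _)) (XY n _).
  apply: (ext_dim_le_left (KY i.+1 _)); first by lia.
    by apply: (ext_dim_le_mono (n := 0)) => //; apply: XY; lia.
  by apply: IHj; lia.
case/ext_dim_le_coresolution_tail=> K [Y [g [f [K0 Kn KY]]]]; subst M.
(* Prepend the triangle 0 -> M -> M. *)
pose K' i : C := if i is j.+1 then K j else zob.
pose Y' i : C := if i is j.+1 then Y j else K 0%N.
pose g' i : Hom (K' i) (Y' i) := if i is j.+1 then g j else 0.
pose f' i : Hom (Y' i) (K' i.+1) := if i is j.+1 then f j else idm (K 0%N).
exists Y', (fun i => g' i.+1 ∘ f' i); split=> // [i /KY[]//|].
exists K', g', f'; split=> //; first exact: is_zero_zob.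
by case=> [_|i /KY[]//]; exact: zero_triangle.
Qed.

End Dimension.

(** * Dimension along the functors of a recollement *)

Lemma exact_ext_dim_le (C D : stdExtriCat) (F : addFun C D) (X : set C)
    (X' : set D) (q n : nat) (M : C) :
  exact_functor F -> (forall M, perp X M -> ext_dim_le X' q (F M)) ->
  ext_dim_le X n M -> ext_dim_le X' (n + q) (F M).
Proof.
move=> [_ [eta [_ _ etaP]]] qF; move: n M.
apply: ext_dim_le_ind => [//|n M I N x y [d dxy] XI nN].
have Fxy : etriangle (fmap F x) (fmap F y).
  by exists (eta N M d); exact: etaP.
rewrite addSn; apply: (ext_dim_le_left Fxy) nN.
by apply: ext_dim_le_mono (qF _ XI); lia.
Qed.

Section Adjoints.
Variables (C D : addCat) (L : addFun C D) (R : addFun D C) (adj : adjunction L R).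

(** The inverse is the preimage under R of the unit at R Y. *)
Lemma counit_iso (Y : D) : fully_faithful R -> is_iso (counit_ adj Y).
Proof.
move=> ffR; have [h hK Kh] := ffR Y (L (R Y)).
have [k kK _] := ffR Y Y.
pose g := h (unit_ adj (R Y)).
have gE : fmap R g = unit_ adj (R Y) by exact: Kh.
exists g; split.
  rewrite (counit_nat adj g) gE; exact: triangleL.
by apply: (can_inj kK); rewrite fmap_comp gE fmap_id triangleR.
Qed.

Lemma unit_iso (Y : C) : fully_faithful L -> is_iso (unit_ adj Y).
Proof.
move=> ffL; have [h hK Kh] := ffL (R (L Y)) Y.
have [k kK _] := ffL Y Y.
pose g := h (counit_ adj (L Y)).
have gE : fmap L g = counit_ adj (L Y) by exact: Kh.
exists g; split.
  by apply: (can_inj kK); rewrite fmap_comp gE fmap_id triangleL.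
rewrite -(unit_nat adj g) gE; exact: triangleR.
Qed.

End Adjoints.

Section Recollement.
Variables (A B C : stdExtriCat) (r : recollement A B C).
Variables (X : set B) (X'' : set C).

(** The counit identifies j^*j_*g with g up to isomorphisms, which are
    deflations and hence can be composed with g. *)
Lemma deflation_jU_jL (Y Z : C) (g : Hom Y Z) :
  deflation g -> deflation (fmap (jU r) (fmap (jL r) g)).
Proof.
move=> dg; have cY := counit_iso (adj_jU_jL r) Y (jL_ff r).
have [e [eK Ke]] := counit_iso (adj_jU_jL r) Z (jL_ff r).
rewrite -(comp1m (fmap _ _)) -eK -compA -counit_nat.
apply: deflation_comp; first by apply: deflation_comp dg; exact: iso_deflation.
by apply: iso_deflation; exists (counit_ (adj_jU_jL r) Z).
Qed.

(** Left exactness of j_* up to an error term T. The inflation y : W' -> j_*W is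
    compatible, hence so is j^*y; as j^*j_*g is a deflation that factors through
    j^*y, (WIC) makes j^*y a deflation as well as an inflation, so an
    isomorphism. Its cone j^*T is therefore 0, and (R2) applies. *)
Lemma jL_triangle (U V W : C) (f : Hom U V) (g : Hom V W) :
  etriangle f g -> exists (W' T : B) (p : Hom (jL r V) W')
    (y : Hom W' (jL r W)) (z : Hom (jL r W) T),
  [/\ etriangle (fmap (jL r) f) p, etriangle y z & fimage (iL r) setT T].
Proof.
move=> [d dfg]; have [_ _ [Z' [y [eta [etaP _]]]]] := jL_left_exact r.
have [p [etap cy [T [z [e eyz]]] gE]] := etaP _ _ _ _ _ _ dfg.
exists (Z' _ _ d), T, p, (y _ _ d), z; split; [by exists (eta W U d)|by exists e|].
apply/im_ker; have [cj [eta' [_ _ eta'P]]] := jU_exact r.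
apply: (@cone_of_iso C _ _ _ (fmap (jU r) (y W U d)) (fmap (jU r) z));
  last by exists (eta' _ _ e); exact: eta'P.
apply: (cj _ _ _ cy).
  by exists (jU r T), (fmap (jU r) z), (eta' _ _ e); exact: eta'P.
apply: (std_WIC C).2 _ _ _ (fmap (jU r) p) _ _.
rewrite -fmap_comp -gE; apply: deflation_jU_jL.
by exists U, f, d.
Qed.

(** In a step U -> V -> W, the middle term W' of [jL_triangle] has dimension at
    most max(dim j_*W, dim T + 1), and j_*U at most one more than that. The
    error term contributes m + 2, which does not exceed the bound n + 1 + m + 1 of
    every step, so the errors do not accumulate. *)
Lemma ext_dim_le_jL (m n : nat) (U : C) :
  (forall N, fimage (iL r) setT N -> ext_dim_le X m N) ->
  (forall N, fimage (jL r) (perp X'') N -> ext_dim_le X m N) ->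
  ext_dim_le X'' n U -> ext_dim_le X (n + m).+1 (jL r U).
Proof.
move=> iA jC; have jm U' : perp X'' U' -> ext_dim_le X m (jL r U').
  by move=> XU'; apply: jC; exists U' => //; exact: isom_refl.
move: n U; apply: ext_dim_le_ind => [U /jm|n U V W f g fg XV nW].
  by apply: ext_dim_le_mono; lia.
have [W' [T [p [y [z [fp yz /iA mT]]]]]] := jL_triangle fg.
rewrite addSn; apply: (ext_dim_le_left fp).
  by apply: ext_dim_le_mono (jm _ XV); lia.
apply: (ext_dim_le_left yz) => //.
by apply: ext_dim_le_mono mT; lia.
Qed.

(** The sequence of (R4) splits into triangles i_*i^!M -> M -> K and
    K -> j_*j^*M -> i_*N, whose outer terms are controlled. *)
Lemma ext_dim_le_gluing (m n : nat) (M : B) :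
  (forall N, fimage (iL r) setT N -> ext_dim_le X m N) ->
  (forall N, fimage (jL r) (perp X'') N -> ext_dim_le X m N) ->
  ext_dim_le X'' n (jU r M) -> ext_dim_le X (n + m).+1 M.
Proof.
move=> iA jC nM; have [N [h [K [g1 [g2 [t1 t2 _ _]]]]]] := left_seq r M.
have iLm N' : ext_dim_le X m (iL r N').
  by apply: iA; exists N' => //; exact: isom_refl.
apply: (ext_dim_le_mid t1); first by apply: ext_dim_le_mono (iLm _); lia.
apply: (ext_dim_le_left t2); first exact: ext_dim_le_jL nM.
by apply: ext_dim_le_mono (iLm _); lia.
Qed.

End Recollement.

(** * Extended integer arithmetic of dimensions *)

Section Dimensions.
Local Open Scope ereal_scope.

(** Together with [adde_le_nat], this reduces inequalities between dimensions to
    finite bounds: nothing has to be shown where the right-hand side is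
    infinite. *)
Lemma le_of_nat_bounds (d e : \bar int) :
  0 <= d -> (forall n : nat, d <= n%:Z%:E -> e <= n%:Z%:E) -> e <= d.
Proof. by case: d => [[n|//]||//] _ ed; [exact: ed | exact: leey]. Qed.

Lemma adde_le_nat (a b : \bar int) (n : nat) :
  0 <= a -> 0 <= b -> a + b <= n%:Z%:E ->
  exists i j : nat, [/\ a <= i%:Z%:E, b <= j%:Z%:E & (i + j <= n)%N].
Proof.
case: a => [[i|//]||//] // _; case: b => [[j|//]||//] // _.
by rewrite -EFinD !lee_fin => ijn; exists i, j.
Qed.

Lemma le_supremum_nneg (T : set (\bar int)) (n : nat) :
  (forall t, T t -> 0 <= t) ->
  supremum 0 T <= n%:Z%:E <-> forall t, T t -> t <= n%:Z%:E.
Proof.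
move=> T0; have [->|/set0P T_neq0] := eqVneq T set0.
  by rewrite supremum0; split=> // _; rewrite lee_fin.
(* The default value of [supremum] is excluded once a least upper bound exists;
   it is the least natural upper bound, or +oo if there is none. *)
suff sup_ex : supremums T !=set0.
  split=> [Tn t Tt|Tn]; first by apply: le_trans Tn; exact: ge_supremum_Nmem.
  rewrite /supremum ifF; last by apply/negP=> /eqP T0'; case: T_neq0; rewrite T0'.
  case: xgetP => [t _ [_ tub]|no_sup]; first exact: tub.
  by case: sup_ex => t /no_sup.
pose bound m := `[< forall t, T t -> t <= m%:Z%:E >].
have [T_fin|T_inf] := pselect (exists m, bound m).
  have [m /asboolP Tm m_min] := ex_minnP T_fin.
  exists m%:Z%:E; split=> // u Tu; case: T_neq0 => t Tt.
  have u0 : 0 <= u by apply: le_trans (Tu t Tt); exact: T0.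
  apply: le_of_nat_bounds => // k uk; rewrite lee_fin; apply: m_min.
  by apply/asboolP=> s Ts; apply: le_trans (Tu s Ts) uk.
exists +oo; split=> [t _|u Tu]; first exact: leey.
case: T_neq0 => t Tt.
have u0 : 0 <= u by apply: le_trans (Tu t Tt); exact: T0.
apply: le_of_nat_bounds => // k uk; case: T_inf; exists k.
by apply/asboolP=> s Ts; apply: le_trans (Tu s Ts) uk.
Qed.

Lemma supremum_ge0 (T : set (\bar int)) :
  (forall t, T t -> 0 <= t) -> 0 <= supremum 0 T.
Proof.
move=> T0; rewrite /supremum; case: ifPn => [//|/set0P[t Tt]].
case: xgetP => [s _ [Ts _]|//].
by apply: le_trans (T0 t Tt) (Ts t Tt).
Qed.

Context {C : stdExtriCat}.

Lemma cores_dim_cases (X : set C) (M : C) :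
  (cores_dim (perp X) M = +oo /\ forall n, ~ ext_dim_le X n M) \/
  exists2 m : nat, cores_dim (perp X) M = m%:Z%:E &
    forall n, ext_dim_le X n M <-> (m <= n)%N.
Proof.
have [fin|inf] := pselect (exists m, `[< ext_dim_le X m M >]).
  have [m /asboolP mM m_min] := ex_minnP fin; right; exists m; last first.
    move=> n; split=> [nM|mn]; first by apply: m_min; exact/asboolP.
    exact: ext_dim_le_mono mM.
  rewrite /cores_dim; set T := [set _ | _ in _].
  have Tm : T m%:Z%:E by exists m => //; exact/coresolution_perp.
  have m_inf : infimums T m%:Z%:E.
    split=> [_ [n /coresolution_perp nM <-]|l]; last exact.
    by rewrite lee_fin; apply: m_min; exact/asboolP.
  rewrite /infimum ifF; last by apply/negP=> /eqP T0; rewrite T0 in Tm.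
  case: xgetP => [t _ t_inf|/(_ _ m_inf)//].
  exact: is_subset1_infimums t_inf m_inf.
left; have noM n : ~ ext_dim_le X n M by move=> nM; apply: inf; exists n; exact/asboolP.
split=> //; rewrite /cores_dim; set T := [set _ | _ in _].
suff -> : T = set0 by rewrite /infimum eqxx.
by rewrite -subset0 => t [n /coresolution_perp /noM].
Qed.

Lemma cores_dim_le (X : set C) (M : C) (n : nat) :
  cores_dim (perp X) M <= n%:Z%:E <-> ext_dim_le X n M.
Proof.
have [[-> noM]|[m -> mM]] := cores_dim_cases X M; last by rewrite lee_fin mM.
by split=> // /noM.
Qed.

Lemma cores_dim_ge0 (X : set C) (M : C) : 0 <= cores_dim (perp X) M.
Proof. by have [[-> _]|[m -> _]] := cores_dim_cases X M; rewrite ?lee_fin. Qed.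

Lemma cores_dim_class_le (X S : set C) (n : nat) :
  cores_dim_class (perp X) S <= n%:Z%:E <-> S `<=` ext_dim_le X n.
Proof.
rewrite le_supremum_nneg => [|_ [M _ <-]]; last exact: cores_dim_ge0.
split=> [Sn M SM|Sn _ [M SM <-]]; last by apply/cores_dim_le; exact: Sn.
by apply/cores_dim_le; apply: Sn; exists M.
Qed.

Lemma cores_dim_class_ge0 (X S : set C) : 0 <= cores_dim_class (perp X) S.
Proof. by apply: supremum_ge0 => _ [M _ <-]; exact: cores_dim_ge0. Qed.

Lemma cores_dim_class_perp (X S : set C) :
  S `<=` perp X -> cores_dim_class (perp X) S = 0.
Proof.
move=> SX; apply/eqP; rewrite eq_le cores_dim_class_ge0 andbT.
exact/(cores_dim_class_le X S 0).
Qed.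

End Dimensions.

Local Open Scope ereal_scope.

(** * The inequalities *)

Lemma cores_dim_class_exact (C D : stdExtriCat) (F : addFun C D) (X : set C)
    (Y S : set D) :
  exact_functor F -> S `<=` fimage F setT ->
  cores_dim_class (perp Y) S
    <= cores_dim_class (perp X) setT + cores_dim_class (perp Y) (fimage F (perp X)).
Proof.
move=> exF SF; apply: le_of_nat_bounds.
  by apply: adde_ge0; exact: cores_dim_class_ge0.
move=> n /adde_le_nat[]; rewrite ?cores_dim_class_ge0 // => i [j [+ + ijn]].
move=> /cores_dim_class_le iX /cores_dim_class_le jF.
apply/cores_dim_class_le=> N /SF[M _ /ext_dim_le_isom]; apply.
apply: (ext_dim_le_mono ijn); apply: (exact_ext_dim_le exF _ (iX M I)).
by move=> M' XM'; apply: jF; exists M' => //; exact: isom_refl.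
Qed.

Lemma cores_dim_class_gluing (A B C : stdExtriCat) (r : recollement A B C)
    (X : set B) (X'' : set C) :
  cores_dim_class (perp X) setT
    <= cores_dim_class (perp X'') setT
       + maxe (cores_dim_class (perp X) (fimage (iL r) setT))
              (cores_dim_class (perp X) (fimage (jL r) (perp X''))) + 1.
Proof.
have ge0 := (@cores_dim_class_ge0).
have max0 : 0 <= maxe (cores_dim_class (perp X) (fimage (iL r) setT))
               (cores_dim_class (perp X) (fimage (jL r) (perp X''))).
  by rewrite le_max ge0.
apply: le_of_nat_bounds; first by rewrite !adde_ge0.
move=> n /adde_le_nat[]; rewrite ?adde_ge0 // => k [l [+ l1 kln]].
have l_gt0 : (0 < l)%N by case: l l1 {kln}.
move=> /adde_le_nat[]; rewrite ?ge0 // => i [j [/cores_dim_class_le iX + ijk]].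
rewrite ge_max => /andP[/cores_dim_class_le jA /cores_dim_class_le jC].
apply/cores_dim_class_le=> M _.
apply: ext_dim_le_mono (ext_dim_le_gluing jA jC (iX _ I)).
by lia.
Qed.

Theorem theorem3p5 (A B C : stdExtriCat) (r : recollement A B C)
    (X' : set A) (X : set B) (X'' : set C)
    (hX' : subcategory X') (hX : subcategory X) (hX'' : subcategory X'') :
  (* (1) *)
  (cores_dim_class (perp X) setT
     <= cores_dim_class (perp X'') setT
        + maxe (cores_dim_class (perp X) (fimage (iL r) setT))
               (cores_dim_class (perp X) (fimage (jL r) (perp X''))) + 1)
  (* (2) *)
  /\ (cores_dim_class (perp X) (fimage (iL r) setT)
        <= cores_dim_class (perp X') setT
           + cores_dim_class (perp X) (fimage (iL r) (perp X')))
  (* (3) *)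
  /\ (cores_dim_class (perp X) setT
        <= cores_dim_class (perp X') setT + cores_dim_class (perp X'') setT
           + maxe (cores_dim_class (perp X) (fimage (iL r) (perp X')))
                  (cores_dim_class (perp X) (fimage (jL r) (perp X''))) + 1)
  (* (4) *)
  /\ (cores_dim_class (perp X'') setT
        <= cores_dim_class (perp X) setT
           + cores_dim_class (perp X'') (fimage (jU r) (perp X)))
  (* (5) *)
  /\ (fimage (jL r) (perp X'') `<=` perp X ->
      fimage (iL r) (perp X') `<=` perp X ->
      cores_dim_class (perp X) setT
        <= cores_dim_class (perp X') setT + cores_dim_class (perp X'') setT + 1)
  (* (6) *)
  /\ (fimage (jU r) (perp X) `<=` perp X'' ->
      cores_dim_class (perp X'') setT <= cores_dim_class (perp X) setT)
  (* (7) *)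
  /\ (exact_functor (iUs r) ->
      fimage (iUs r) (perp X) `<=` perp X' ->
      cores_dim_class (perp X') setT <= cores_dim_class (perp X) setT)
  (* (8) *)
  /\ (exact_functor (iUs r) ->
      fimage (jL r) (perp X'') `<=` perp X ->
      fimage (jU r) (perp X) `<=` perp X'' ->
      fimage (iL r) (perp X') `<=` perp X ->
      fimage (iUs r) (perp X) `<=` perp X' ->
      maxe (cores_dim_class (perp X') setT) (cores_dim_class (perp X'') setT)
        <= cores_dim_class (perp X) setT
        <= cores_dim_class (perp X') setT + cores_dim_class (perp X'') setT + 1).
Proof.
have p1 := cores_dim_class_gluing r X X''.
have p2 := cores_dim_class_exact X' X (iL_exact r) (@subset_refl _ (fimage (iL r) setT)).
have p3 : cores_dim_class (perp X) setT
    <= cores_dim_class (perp X') setT + cores_dim_class (perp X'') setT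
       + maxe (cores_dim_class (perp X) (fimage (iL r) (perp X')))
              (cores_dim_class (perp X) (fimage (jL r) (perp X''))) + 1.
  apply: le_trans p1 _; apply: leeD2r.
  rewrite [_ (perp X') _ + _]addeC -addeA; apply: leeD2l.
  rewrite ge_max; apply/andP; split.
    by apply: le_trans p2 _; apply: leeD2l; rewrite le_max lexx.
  by rewrite (le_trans _ (leeDr _ (cores_dim_class_ge0 _ _))) // le_max lexx orbT.
have p4 : cores_dim_class (perp X'') setT
    <= cores_dim_class (perp X) setT
       + cores_dim_class (perp X'') (fimage (jU r) (perp X)).
  apply: cores_dim_class_exact (jU_exact r) _ => N _; exists (jL r N) => //.
  by exists (counit_ (adj_jU_jL r) N); exact: counit_iso (jL_ff r).
have p5 : fimage (jL r) (perp X'') `<=` perp X ->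
    fimage (iL r) (perp X') `<=` perp X ->
    cores_dim_class (perp X) setT
      <= cores_dim_class (perp X') setT + cores_dim_class (perp X'') setT + 1.
  by move=> jX iX; move: p3;
    rewrite (cores_dim_class_perp iX) (cores_dim_class_perp jX) maxxx adde0.
have p6 : fimage (jU r) (perp X) `<=` perp X'' ->
    cores_dim_class (perp X'') setT <= cores_dim_class (perp X) setT.
  by move=> jX; move: p4; rewrite (cores_dim_class_perp jX) adde0.
have p7 : exact_functor (iUs r) -> fimage (iUs r) (perp X) `<=` perp X' ->
    cores_dim_class (perp X') setT <= cores_dim_class (perp X) setT.
  move=> exi iX; rewrite -[leRHS]adde0 -(cores_dim_class_perp iX).
  apply: cores_dim_class_exact exi _ => N _; exists (iL r N) => //.
  apply: isom_sym; exists (unit_ (adj_iL_iUs r) N); exact: unit_iso (iL_ff r).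
do 7![split=> //] => exi jX jX' iX iX'.
by rewrite ge_max p7 // p6 //= p5.
Qed.
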